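(* Let $\Xi=\{\xi\in\mathbb{R}^{m(n+1)}:\ \|F\xi\|_2\le 1\}$, where $F$ is a real matrix with $n_q$ rows and $m(n+1)$ columns, and assume $\Xi$ is compact. Let $P=[P_1,\dots,P_m]$, $P_j\in\mathbb{R}^{n_0\times(n+1)}$, be a matrix of full row rank and let $\Omega$ be a pole-set of $P\Xi$. Fix $u\in\mathbb{R}^n$, $(v_\omega)_{\omega\in\Omega}\subset\mathbb{R}^q$ and $i\in\{1,\dots,m\}$. Then the $i$-th constraint of the multipolar robust counterpart, $$U_iu+V_i\sum_{\omega\in\Omega}\lambda_\omega v_\omega\le b_i\qquad\text{for all }\xi\equiv[U,b]\in\Xi,\ \lambda\in\Lambda_\xi,$$ holds if and only if there exist $\eta_i\in\mathbb{R}^{n_q}$ and $\sigma_i\in\mathbb{R}^{n_0}$ such that $$\|\eta_i\|_2+V_iv_\omega-\omega^T\sigma_i\le 0\quad\text{for all }\omega\in\Omega,\qquad F^T\eta_i-L_i=0,$$ where $L_i=(L_{i1},\dots,L_{im})$ is the column vector obtained by stacking the blocks $L_{ij}=\delta_{ij}(u,-1)+P_j^T\sigma_i\in\mathbb{R}^{n+1}$, $j=1,\dots,m$.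
   Context: An uncertain parameter $\xi\equiv[U,b]$, with $U\in\mathbb{R}^{m\times n}$, $b\in\mathbb{R}^m$, is written as a column vector of size $m(n+1)$ made of $m$ blocks of size $n+1$: the $i$-th block is $U_i^T$ (transpose of the $i$-th row of $U$) followed by $b_i$. The matrix $P$ is partitioned by columns accordingly. $V\in\mathbb{R}^{m\times q}$ is fixed with $i$-th row $V_i$. $(u,-1)\in\mathbb{R}^{n+1}$ is the column vector $u$ followed by $-1$; $\delta_{ij}$ is the Kronecker delta. A pole-set of $P\Xi=\{P\xi:\xi\in\Xi\}$ is a finite set $\Omega\subset\mathbb{R}^{n_0}$ with $P\Xi\subseteq\operatorname{conv}\Omega$, and for $\xi\in\Xi$, $\Lambda_\xi=\{\lambda\in\mathbb{R}^\Omega_{\ge0}:\sum_\omega\lambda_\omega\omega=P\xi,\ \sum_\omega\lambda_\omega=1\}$. *)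

(* Defs.v *)
From HB Require Import structures.
From mathcomp Require Import all_boot all_order all_algebra finmap.
From mathcomp Require Import all_classical all_reals all_analysis.

Set Implicit Arguments.
Unset Strict Implicit.
Unset Printing Implicit Defensive.

Import Order.TTheory GRing.Theory Num.Theory.
Import numFieldNormedType.Exports.

Local Open Scope classical_set_scope.
Local Open Scope ring_scope.

(* The norm `|x| of the library on matrices is the sup norm. *)
Definition norm2 (R : realType) (p : nat) (x : 'cV[R]_p) : R :=
  Num.sqrt (\sum_(k < p) x k 0 ^+ 2).

(* Entry k of block j sits at position j * p + k, which is what
   mxvec_index j k denotes. *)
Definition stack (R : realType) (m p : nat) (x : 'I_m -> 'cV[R]_p) :
    'cV[R]_(m * p) :=
  (mxvec (\matrix_(j < m, k < p) x j k 0))^T.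

(* [col_block P j] is P_j when P = [P_0, ..., P_(m-1)] is cut into m groups of
   p consecutive columns. *)
Definition col_block (R : realType) (n0 m p : nat) (P : 'M[R]_(n0, m * p))
    (j : 'I_m) : 'M[R]_(n0, p) :=
  \matrix_(r < n0, k < p) P r (mxvec_index j k).

(* The column vector written [U, b]. *)
Definition param (R : realType) (m n : nat) (U : 'M[R]_(m, n)) (b : 'cV[R]_m) :
    'cV[R]_(m * (n + 1)) :=
  stack (fun j => col_mx (row j U)^T (row j b)).

Definition ellipsoid (R : realType) (nq N : nat) (F : 'M[R]_(nq, N)) :
    set 'cV[R]_N :=
  [set xi | norm2 (F *m xi) <= 1].

(* Lambda_xi is [weights Omega (P *m xi)]. *)
Definition weights (R : realType) (n0 : nat) (Omega : {fset 'cV[R]_n0})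
    (x : 'cV[R]_n0) : set (Omega -> R) :=
  [set lam | [/\ forall w, 0 <= lam w,
                 \sum_(w : Omega) lam w *: val w = x &
                 \sum_(w : Omega) lam w = 1]].

Arguments weights {R n0} Omega x _.

Definition conv (R : realType) (n0 : nat) (Omega : {fset 'cV[R]_n0}) :
    set 'cV[R]_n0 :=
  [set x | exists lam, weights Omega x lam].

Definition pole_set (R : realType) (n0 N : nat) (P : 'M[R]_(n0, N))
    (Xi : set 'cV[R]_N) (Omega : {fset 'cV[R]_n0}) : Prop :=
  [set P *m xi | xi in Xi] `<=` conv Omega.

(* The i-th constraint of the multipolar robust counterpart. *)
Definition multipolar_constraint (R : realType) (m n q n0 : nat)
    (Xi : set 'cV[R]_(m * (n + 1))) (P : 'M[R]_(n0, m * (n + 1)))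
    (Omega : {fset 'cV[R]_n0}) (V : 'M[R]_(m, q)) (u : 'cV[R]_n)
    (v : Omega -> 'cV[R]_q) (i : 'I_m) : Prop :=
  forall (U : 'M[R]_(m, n)) (b : 'cV[R]_m), Xi (param U b) ->
  forall lam : Omega -> R, weights Omega (P *m param U b) lam ->
    (row i U *m u) 0 0 + (row i V *m \sum_(w : Omega) lam w *: v w) 0 0
      <= b i 0.

Definition Lvec (R : realType) (m n n0 : nat) (P : 'M[R]_(n0, m * (n + 1)))
    (u : 'cV[R]_n) (i : 'I_m) (sigma : 'cV[R]_n0) : 'cV[R]_(m * (n + 1)) :=
  stack (fun j => (i == j)%:R *: col_mx u (const_mx (-1))
                  + (col_block P j)^T *m sigma).

(* Main.v *)
Require Import Defs.
From HB Require Import structures.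
From mathcomp Require Import all_boot all_order all_algebra finmap.
From mathcomp Require Import all_classical all_reals all_analysis.
From mathcomp Require Import ring lra.

Set Implicit Arguments.
Unset Strict Implicit.
Unset Printing Implicit Defensive.

Import Order.TTheory GRing.Theory Num.Theory.
Import numFieldNormedType.Exports.

Local Open Scope classical_set_scope.
Local Open Scope ring_scope.

(* The values of [(P xi - x, c xi + sum_w lam_w g_w)], for [xi] in the ellipsoid
   and [lam] weights of [x], form a convex set in which the robust constraint
   bounds the last coordinate by 0 above the origin.  Since [P] has full row
   rank, the first component reaches every direction from 0, so a nonvertical
   hyperplane separates: its slope is [sigma].  Then [Lvec P u i sigma] is
   bounded on the ellipsoid and its maximum there is the norm of some [eta] with
   [F^T eta = Lvec P u i sigma].  The converse is the Cauchy-Schwarz inequality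
   for [eta] and [F xi], averaged over the weights. *)

(** * Separation by a nonvertical hyperplane *)

(* The one-dimensional extension step of the Hahn-Banach theorem, iterated over
   the coordinates: the slope [a] along the first coordinate is squeezed
   between the quotients coming from the points on either side of 0. *)
Lemma convex_slope (R : realType) (k : nat) (K : 'cV[R]_k -> R -> Prop) :
  (forall y1 t1 y2 t2 a b, 0 <= a -> 0 <= b -> a + b = 1 ->
     K y1 t1 -> K y2 t2 -> K (a *: y1 + b *: y2) (a * t1 + b * t2)) ->
  (forall y, exists e t, 0 < e /\ K (e *: y) t) ->
  (forall t, K 0 t -> t <= 0) ->
  exists s : 'cV[R]_k, forall y t, K y t -> t + (s^T *m y) 0 0 <= 0.
Proof.
elim: k K => [|k IH].
  move=> K _ _ K0; exists 0 => y t; rewrite (flatmx0 y) => /K0.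
  by rewrite mulmx0 mxE addr0.
rewrite -[k.+1]/(1 + k)%N => K Kconv Kcore K0.
(* The slice of [K] over first coordinate 0 inherits the three hypotheses in dimension [k]. *)
have [s Ks] : exists s : 'cV[R]_k,
    forall y t, K (col_mx 0 y) t -> t + (s^T *m y) 0 0 <= 0.
  apply: (IH (fun y => K (col_mx 0 y))).
  - move=> y1 t1 y2 t2 a b a0 b0 ab1 K1 K2.
    have := Kconv _ _ _ _ _ _ a0 b0 ab1 K1 K2.
    by rewrite !scale_col_mx add_col_mx !scaler0 addr0.
  - move=> y; have [e [t [e0 Ke]]] := Kcore (col_mx 0 y).
    by exists e, t; split => //; rewrite scale_col_mx scaler0 in Ke.
  - by move=> t; rewrite col_mx0; apply: K0.
pose o : 'I_(1 + k) := lshift k 0.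
pose g (y : 'cV[R]_(1 + k)) t : R := t + (s^T *m dsubmx y) 0 0.
have g_comb a b y1 t1 y2 t2 :
    g (a *: y1 + b *: y2) (a * t1 + b * t2) = a * g y1 t1 + b * g y2 t2.
  rewrite /g linearD !linearZ /= mulmxDr -!scalemxAr !mxE; ring.
have g_le0 y t : K y t -> y o 0 = 0 -> g y t <= 0.
  move=> Kyt yo; apply: Ks; suff <- : usubmx y = 0 by rewrite vsubmxK.
  by apply/matrixP => p r; rewrite !mxE !ord1.
(* Weights proportional to [y2 o 0] and [- y1 o 0] cancel the first coordinate, so the combination
   falls in the slice, where [g] is nonpositive. *)
have cross y1 t1 y2 t2 : K y1 t1 -> K y2 t2 -> y1 o 0 < 0 -> 0 < y2 o 0 ->
    g y1 t1 / - y1 o 0 <= - g y2 t2 / y2 o 0.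
  move=> K1 K2 y1lt y2gt.
  have D0 : 0 < y2 o 0 - y1 o 0 by lra.
  have := Kconv _ _ _ _ (y2 o 0 / (y2 o 0 - y1 o 0))
    (- y1 o 0 / (y2 o 0 - y1 o 0)) _ _ _ K1 K2.
  move=> /(_ _ _ _)/g_le0; rewrite g_comb !mxE => H.
  have {}H : y2 o 0 / (y2 o 0 - y1 o 0) * g y1 t1 +
    - y1 o 0 / (y2 o 0 - y1 o 0) * g y2 t2 <= 0.
    apply: H.
    - by rewrite divr_ge0 // ltW.
    - by rewrite divr_ge0 // ?oppr_ge0 ltW.
    - by rewrite -mulrDl divff // gt_eqF.
    - by field; rewrite gt_eqF.
  rewrite ler_pdivrMr ?oppr_gt0 // mulrAC ler_pdivlMr //.
  have : (y2 o 0 * g y1 t1 - y1 o 0 * g y2 t2) / (y2 o 0 - y1 o 0) <= 0.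
    apply: le_trans H; rewrite le_eqVlt; apply/orP; left; apply/eqP.
    by field; rewrite gt_eqF.
  rewrite ler_pdivrMr // mul0r; nra.
(* A slope [a] is wanted with [g y t + a * y o 0 <= 0] on [K]. Points with [y o 0 < 0] give the
   lower bounds on [a] collected in [A], and those with [y o 0 > 0] give upper bounds. *)
pose A := [set x : R | exists y t,
  [/\ K y t, y o 0 < 0 & x = g y t / - y o 0]].
(* Points of [K] on both sides of 0 make [A] nonempty and bounded above, so [sup A] is a genuine
   least upper bound. *)
have [e1 [t1 [e1_gt0 K1]]] := Kcore (const_mx (-1)).
have [e2 [t2 [e2_gt0 K2]]] := Kcore (const_mx 1).
have A_neq0 : A !=set0.
  exists (g (e1 *: const_mx (-1)) t1
    / - (e1 *: const_mx (-1) : 'cV_(1 + k)) o 0).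
  by exists (e1 *: const_mx (-1)), t1; split => //; rewrite !mxE; lra.
have A_ub y t : K y t -> 0 < y o 0 -> ubound A (- g y t / y o 0).
  move=> Kyt y_gt0 _ [y' [t' [Ky't' y'_lt0 ->]]]; exact: cross.
have A_sup : has_sup A.
  split => //; exists (- g (e2 *: const_mx 1) t2
    / (e2 *: const_mx 1 : 'cV_(1 + k)) o 0).
  by apply: A_ub => //; rewrite !mxE; lra.
exists (col_mx (sup A)%:M s) => y t Kyt.
have -> : t + ((col_mx (sup A)%:M s)^T *m y) 0 0 = g y t + sup A * y o 0.
  rewrite /g -{1}[y]vsubmxK tr_col_mx mul_row_col mxE.
  by rewrite tr_scalar_mx mul_scalar_mx !mxE; ring.
have [y_lt0|y_gt0|y_eq0] := ltgtP (y o 0) 0.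
- have : g y t / - y o 0 <= sup A.
    by apply: sup_upper_bound => //; exists y, t.
  rewrite ler_pdivrMr ?oppr_gt0 //; lra.
- have : sup A <= - g y t / y o 0 by apply: ge_sup => //; exact: A_ub.
  rewrite ler_pdivlMr //; lra.
- by rewrite y_eq0 mulr0 addr0; apply: g_le0.
Qed.

(** * Euclidean norm *)

Lemma norm2_ge0 (R : realType) (p : nat) (x : 'cV[R]_p) : 0 <= norm2 x.
Proof. exact: sqrtr_ge0. Qed.

Lemma norm2_sqr (R : realType) (p : nat) (x : 'cV[R]_p) :
  norm2 x ^+ 2 = (x^T *m x) 0 0.
Proof.
rewrite sqr_sqrtr; last by apply: sumr_ge0 => k _; exact: sqr_ge0.
by rewrite mxE; apply: eq_bigr => k _; rewrite mxE expr2.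
Qed.

Lemma norm2_eq0 (R : realType) (p : nat) (x : 'cV[R]_p) :
  norm2 x = 0 -> x = 0.
Proof.
move=> /eqP; rewrite sqrtr_eq0 => xle0.
have sum0 : \sum_k x k 0 ^+ 2 = 0.
  by apply/eqP; rewrite eq_le xle0 sumr_ge0 // => k _; exact: sqr_ge0.
apply/matrixP => k l; rewrite ord1 mxE; apply/eqP.
rewrite -sqrf_eq0; apply/eqP.
by apply: (psumr_eq0P _ sum0) => // j _; exact: sqr_ge0.
Qed.

Lemma norm2Z (R : realType) (p : nat) (a : R) (x : 'cV[R]_p) :
  norm2 (a *: x) = `|a| * norm2 x.
Proof.
apply/eqP; rewrite -(@eqrXn2 _ 2) ?mulr_ge0 ?norm2_ge0 //.
rewrite exprMn !norm2_sqr real_normK ?num_real //.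
by rewrite [(a *: x)^T]linearZ /= -scalemxAl -scalemxAr scalerA mxE -expr2.
Qed.

Lemma norm2_0 (R : realType) (p : nat) : norm2 (0 : 'cV[R]_p) = 0.
Proof. by rewrite -(scale0r 0) norm2Z normr0 mul0r. Qed.

Lemma dotmxC (R : realType) (p : nat) (x y : 'cV[R]_p) :
  (x^T *m y) 0 0 = (y^T *m x) 0 0.
Proof. by rewrite -[y in LHS]trmxK -trmx_mul mxE. Qed.

(** For [z = norm2 y *: x - norm2 x *: y], the square of [norm2 z] is twice [norm2 x * norm2 y]
    times the gap in the inequality. Zero vectors are set aside to allow dividing by that
    product. *)
Lemma cauchy_schwarz (R : realType) (p : nat) (x y : 'cV[R]_p) :
  (x^T *m y) 0 0 <= norm2 x * norm2 y.
Proof.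
have [x0|x_neq0] := eqVneq (norm2 x) 0.
  by rewrite (norm2_eq0 x0) trmx0 mul0mx mxE mulr_ge0 ?norm2_ge0.
have [y0|y_neq0] := eqVneq (norm2 y) 0.
  by rewrite (norm2_eq0 y0) mulmx0 mxE mulr_ge0 ?norm2_ge0.
have xy_gt0 : 0 < norm2 x * norm2 y.
  by rewrite mulr_gt0 // lt_def ?x_neq0 ?y_neq0 norm2_ge0.
have := sqr_ge0 (norm2 (norm2 y *: x - norm2 x *: y)).
rewrite norm2_sqr [(_ - _)^T]linearB /= ![(_ *: _)^T]linearZ /=.
rewrite mulmxBl !mulmxBr -!scalemxAl -!scalemxAr.
move: (dotmxC y x) (norm2_sqr x) (norm2_sqr y).
move: (x^T *m x) (x^T *m y) (y^T *m x) (y^T *m y) => xx xy yx yy.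
rewrite !mxE => -> <- <- H.
rewrite -(ler_pM2l xy_gt0); lra.
Qed.

Lemma norm2D (R : realType) (p : nat) (x y : 'cV[R]_p) :
  norm2 (x + y) <= norm2 x + norm2 y.
Proof.
rewrite -(@ler_pXn2r _ 2) ?nnegrE ?addr_ge0 ?norm2_ge0 //.
have := cauchy_schwarz x y; have := dotmxC y x.
rewrite sqrrD !norm2_sqr [(x + y)^T]linearD /= mulmxDl !mulmxDr.
move: (x^T *m x) (x^T *m y) (y^T *m x) (y^T *m y) => xx xy yx yy.
rewrite !mxE; lra.
Qed.

(** * Block vectors and the parameter space *)

Lemma dot_stack (R : realType) (m p : nat) (a b : 'I_m -> 'cV[R]_p) :
  (stack a)^T *m stack b = \sum_j (a j)^T *m b j.
Proof.
apply/matrixP => r s; rewrite !ord1 summxE mxE.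
rewrite (reindex _ (curry_mxvec_bij _ _)) /=.
under [in RHS]eq_bigr => j _ do rewrite mxE.
rewrite pair_bigA /=; apply: eq_bigr => -[j k] _ /=.
by rewrite /stack trmxK [in X in _ * X]mxE !mxvecE !mxE.
Qed.

Lemma param_surj (R : realType) (m n : nat) (xi : 'cV[R]_(m * (n + 1))) :
  exists U b, param U b = xi.
Proof.
exists (\matrix_(j, k) xi (mxvec_index j (lshift 1 k)) 0).
exists (\col_j xi (mxvec_index j (rshift n 0)) 0).
apply/matrixP => r s; rewrite !ord1; case/mxvec_indexP: r => j k.
rewrite /param /stack mxE mxvecE mxE.
case: (split_ordP k) => l ->; rewrite ?col_mxEu ?col_mxEd !mxE //.
by rewrite !ord1.
Qed.

(** The dependence on [sigma] is affine: the constant part serves as [c] in [multipolar_slope], and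
    the slope found there enters through [P^T]. *)
Lemma LvecE (R : realType) (m n n0 : nat) (P : 'M[R]_(n0, m * (n + 1)))
    (u : 'cV[R]_n) (i : 'I_m) (sigma : 'cV[R]_n0) :
  Lvec P u i sigma = Lvec P u i 0 + P^T *m sigma.
Proof.
apply/matrixP => r s; rewrite !ord1; case/mxvec_indexP: r => j k.
rewrite /Lvec /stack [in RHS]mxE !(mxE, mxvecE).
rewrite [X in _ = _ + X + _]big1 => [|l _]; last first.
  by rewrite [(0 : 'cV_n0) _ _]mxE mulr0.
by rewrite addr0; congr (_ + _); apply: eq_bigr => l _; rewrite !mxE.
Qed.

Lemma Lvec0_param (R : realType) (m n n0 : nat) (P : 'M[R]_(n0, m * (n + 1)))
    (u : 'cV[R]_n) (i : 'I_m) (U : 'M[R]_(m, n)) (b : 'cV[R]_m) :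
  ((Lvec P u i 0)^T *m param U b) 0 0 = (row i U *m u) 0 0 - b i 0.
Proof.
rewrite dot_stack (bigD1 i) //= big1 => [|j /negPf ji]; last first.
  by rewrite eq_sym ji scale0r mulmx0 addr0 trmx0 mul0mx.
rewrite eqxx scale1r mulmx0 !addr0 tr_col_mx mul_row_col -trmx_mul !mxE.
by rewrite big_ord1 !mxE mulN1r.
Qed.

(** * Linear forms on the ellipsoid *)

(** For each column [z] of [Z], the number [z^T F^T F z] is the squared norm of [F z]. *)
Lemma kernel_gram (R : realType) (p N k : nat) (F : 'M[R]_(p, N))
    (Z : 'M[R]_(N, k)) :
  F^T *m F *m Z = 0 -> F *m Z = 0.
Proof.
move=> FFZ; apply/matrixP => r j; rewrite [RHS]mxE.
suff /matrixP/(_ r 0) : col j (F *m Z) = 0 by rewrite !mxE.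
apply/norm2_eq0/eqP; rewrite -sqrf_eq0 norm2_sqr colE -mulmxA trmx_mul.
by rewrite -mulmxA [F^T *m _]mulmxA [F^T *m F *m _]mulmxA FFZ mul0mx mulmx0 mxE.
Qed.

(* Boundedness makes [h] vanish on the kernel of [F], which is that of [F^T F],
   so that [h = F^T (F xi0)]; then take [eta = F xi0] and for [xi] the
   normalized [xi0]. *)
Lemma ellipsoid_support (R : realType) (p N : nat) (F : 'M[R]_(p, N))
    (h : 'cV[R]_N) (M : R) :
  (forall xi, ellipsoid F xi -> (h^T *m xi) 0 0 <= M) ->
  exists2 eta, F^T *m eta = h &
    exists2 xi, ellipsoid F xi & norm2 eta = (h^T *m xi) 0 0.
Proof.
move=> hM.
have h_ker (z : 'cV[R]_N) : F *m z = 0 -> (h^T *m z) 0 0 = 0.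
  move=> Fz; apply/eqP/negP => /negP hz_neq0.
  (* This multiple of [z] stays in the ellipsoid because [F z = 0], yet the form takes the value
     [M + 1] there. *)
  have := hM ((M + 1) / (h^T *m z) 0 0 *: z).
  rewrite /ellipsoid /= -!scalemxAr Fz scaler0 norm2_0 mxE divfK //.
  by move=> /(_ ler01); lra.
(* The columns of [cokermx (F^T *m F)] lie in the kernel of [F], so [h] vanishes on them. The point
   [xi0] is [D^T]. *)
have /submxP[D hD] : (h^T <= F^T *m F)%MS.
  rewrite submxE; apply/eqP/matrixP => r j; rewrite ord1 [RHS]mxE.
  have Fz : F *m col j (cokermx (F^T *m F)) = 0.
    by apply: kernel_gram; rewrite colE mulmxA mulmx_coker mul0mx.
  move: (cokermx _) Fz => C Fz.
  by rewrite -[RHS](h_ker _ Fz) colE mulmxA -colE [in RHS]mxE.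
have hE : h = F^T *m (F *m D^T).
  by rewrite -[h]trmxK hD !trmx_mul trmxK mulmxA.
have hDT : (h^T *m D^T) 0 0 = norm2 (F *m D^T) ^+ 2.
  by rewrite norm2_sqr [in LHS]hE trmx_mul trmxK -mulmxA.
exists (F *m D^T) => //.
have [eta0|eta_neq0] := eqVneq (norm2 (F *m D^T)) 0.
  exists 0; last by rewrite mulmx0 mxE.
  by rewrite /ellipsoid /= mulmx0 norm2_0.
exists ((norm2 (F *m D^T))^-1 *: D^T).
  rewrite /ellipsoid /= -scalemxAr norm2Z.
  by rewrite ger0_norm ?invr_ge0 ?norm2_ge0 // mulVf.
by rewrite -scalemxAr mxE hDT expr2 mulKf.
Qed.

Lemma ellipsoid_convex (R : realType) (p N : nat) (F : 'M[R]_(p, N))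
    (xi1 xi2 : 'cV[R]_N) (a b : R) :
  0 <= a -> 0 <= b -> a + b = 1 ->
  ellipsoid F xi1 -> ellipsoid F xi2 -> ellipsoid F (a *: xi1 + b *: xi2).
Proof.
rewrite /ellipsoid /= => a0 b0 ab1 h1 h2; rewrite mulmxDr -!scalemxAr.
apply: le_trans (norm2D _ _) _; rewrite !norm2Z !ger0_norm //; nra.
Qed.

Lemma ellipsoid_absorbing (R : realType) (p N : nat) (F : 'M[R]_(p, N))
    (xi : 'cV[R]_N) :
  exists2 e, 0 < e & ellipsoid F (e *: xi).
Proof.
have d_gt0 : 0 < 1 + norm2 (F *m xi) by have := norm2_ge0 (F *m xi); lra.
exists (1 + norm2 (F *m xi))^-1; first by rewrite invr_gt0.
rewrite /ellipsoid /= -scalemxAr norm2Z ger0_norm; last first.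
  by rewrite invr_ge0 ltW.
by rewrite ler_pdivrMl // mulr1 lerDr.
Qed.

Lemma ellipsoid0 (R : realType) (p N : nat) (F : 'M[R]_(p, N)) :
  ellipsoid F 0.
Proof.
by have [e _] := ellipsoid_absorbing F 0; rewrite scaler0.
Qed.

(** * Separation for the robust constraint *)

(** [sigma] prices the mismatch [P xi - x], which frees the weights from [xi]: the bound then holds
    for each [xi] and each pole independently. *)
Lemma multipolar_slope (R : realType) (N n0 p : nat) (F : 'M[R]_(p, N))
    (P : 'M[R]_(n0, N)) (Omega : {fset 'cV[R]_n0}) (c : 'cV[R]_N)
    (g : Omega -> R) :
  row_free P -> pole_set P (ellipsoid F) Omega ->
  (forall xi lam, ellipsoid F xi -> weights Omega (P *m xi) lam ->
     (c^T *m xi) 0 0 + \sum_w lam w * g w <= 0) ->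
  exists sigma : 'cV[R]_n0, forall xi w, ellipsoid F xi ->
    ((c + P^T *m sigma)^T *m xi) 0 0 <= ((val w)^T *m sigma) 0 0 - g w.
Proof.
move=> /row_freeP[B PB] poles robust.
pose K (y : 'cV[R]_n0) (t : R) := exists xi x lam,
  [/\ ellipsoid F xi, weights Omega x lam, y = P *m xi - x &
      t = (c^T *m xi) 0 0 + \sum_w lam w * g w].
have [||t [xi [x [lam [Exi Wx /eqP]]]]|sigma Hsigma] := @convex_slope R n0 K.
- move=> y1 t1 y2 t2 a b a0 b0 ab1.
  move=> [xi1 [x1 [lam1 [E1 [p1 m1 s1] {y1}-> {t1}->]]]].
  move=> [xi2 [x2 [lam2 [E2 [p2 m2 s2] {y2}-> {t2}->]]]].
  exists (a *: xi1 + b *: xi2), (a *: x1 + b *: x2).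
  exists (fun w => a * lam1 w + b * lam2 w); split.
  + exact: ellipsoid_convex.
  + split => [w||]; first by rewrite addr_ge0 ?mulr_ge0.
      rewrite -m1 -m2 !scaler_sumr -big_split /=; apply: eq_bigr => w _.
      by rewrite scalerDl !scalerA.
    by rewrite big_split /= -!mulr_sumr s1 s2 !mulr1.
  + rewrite mulmxDr -!scalemxAr !scalerBr opprD !addrA; congr (_ - _).
    by rewrite addrAC.
  + under [in RHS]eq_bigr => w _ do rewrite mulrDl -!mulrA.
    rewrite big_split /= -!mulr_sumr mulmxDr -!scalemxAr !mxE; ring.
(* The right inverse [B] sends [y] to a parameter whose image under [P] is [y]; pairing it with
   [x = 0 = P 0], which is in the hull, leaves the mismatch [e *: y]. *)
- move=> y; have [e e_gt0 Ey] := ellipsoid_absorbing F (B *m y).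
  have [lam Wlam] : Defs.conv Omega 0.
    by apply: poles; exists 0; [exact: ellipsoid0|rewrite mulmx0].
  exists e; eexists; split => //.
  exists (e *: (B *m y)), 0, lam; split => //.
  by rewrite subr0 -scalemxAr mulmxA PB mul1mx.
- rewrite eq_sym subr_eq0 => /eqP xE ->; apply: robust => //.
  by rewrite xE.
exists sigma => xi w Exi.
(* Unit mass at the pole [w], so that [x] is [w] itself. *)
pose lam w' : R := (w' == w)%:R.
have sum_lam (f : Omega -> R) : \sum_w' lam w' * f w' = f w.
  rewrite (bigD1 w) //= big1 => [|w' /negPf w'w].
    by rewrite /lam eqxx mul1r addr0.
  by rewrite /lam w'w mul0r.
have Wlam : weights Omega (val w) lam.
  split => [w'||]; first exact: ler0n.
    rewrite (bigD1 w) //= big1 => [|w' /negPf w'w].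
      by rewrite /lam eqxx scale1r addr0.
    by rewrite /lam w'w scale0r.
  by have := sum_lam (fun=> 1); under eq_bigr do rewrite mulr1.
have := Hsigma (P *m xi - val w) _ (ex_intro _ xi (ex_intro _ _
  (ex_intro _ lam (And4 Exi Wlam erefl erefl)))).
rewrite sum_lam mulmxBr (dotmxC (val w)).
rewrite [(c + _)^T]linearD /= trmx_mul trmxK mulmxDl -mulmxA.
move: (c^T *m xi) (sigma^T *m (P *m xi)) (sigma^T *m val w) => A1 A2 A3.
rewrite !mxE; lra.
Qed.

Theorem mainTheorem10 (R : realType) (m n q n0 nq : nat)
    (F : 'M[R]_(nq, m * (n + 1))) (V : 'M[R]_(m, q))
    (P : 'M[R]_(n0, m * (n + 1))) (Omega : {fset 'cV[R]_n0})
    (hXi : compact (ellipsoid F))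
    (hP : row_free P)
    (hOmega : pole_set P (ellipsoid F) Omega)
    (u : 'cV[R]_n) (v : Omega -> 'cV[R]_q) (i : 'I_m) :
  multipolar_constraint (ellipsoid F) P V u v i <->
  exists (eta : 'cV[R]_nq) (sigma : 'cV[R]_n0),
    (forall w : Omega,
       norm2 eta + (row i V *m v w) 0 0 - ((val w)^T *m sigma) 0 0 <= 0) /\
    F^T *m eta - Lvec P u i sigma = 0.
Proof.
pose g (w : Omega) : R := (row i V *m v w) 0 0.
have V_sum lam :
    (row i V *m \sum_w lam w *: v w) 0 0 = \sum_w lam w * g w.
  rewrite mulmx_sumr summxE; apply: eq_bigr => w _.
  by rewrite -scalemxAr mxE.
split=> [robust|[eta [sigma [Hw /eqP]]]]; last first.
  rewrite subr_eq0 LvecE => /eqP Feta U b Exi lam [lam_ge0 lamP lam1].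
  rewrite V_sum -subr_ge0.
  (* Pair [F^T eta = Lvec P u i sigma] with the parameter, and expand its image under [P] over the
     poles. *)
  have rowE : (row i U *m u) 0 0 - b i 0 =
      (eta^T *m (F *m param U b)) 0 0
      - \sum_w lam w * ((val w)^T *m sigma) 0 0.
    have -> : \sum_w lam w * ((val w)^T *m sigma) 0 0
        = (sigma^T *m (P *m param U b)) 0 0.
      rewrite -lamP mulmx_sumr summxE; apply: eq_bigr => w _.
      by rewrite -scalemxAr [RHS]mxE (dotmxC (val w)).
    move: (Lvec0_param P u i U b); move: (Lvec _ _ _ _) Feta => c Feta <-.
    have := congr1 (fun h => (h^T *m param U b) 0 0) Feta.
    rewrite /= [(_ + _)^T]linearD /= !trmx_mul !trmxK mulmxDl -!mulmxA.
    by rewrite [in X in _ = X -> _]mxE => ->; rewrite addrK.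
  (* Average of the pole inequalities; since the weights sum to 1, [norm2 eta] comes out
     unchanged. *)
  have slack : 0 <= \sum_w lam w *
      (((val w)^T *m sigma) 0 0 - norm2 eta - g w).
    apply: sumr_ge0 => w _; apply: mulr_ge0 => //.
    by have := Hw w; rewrite -/(g w); lra.
  have {slack} : \sum_w lam w * g w + norm2 eta
      <= \sum_w lam w * ((val w)^T *m sigma) 0 0.
    rewrite -[norm2 eta]mul1r -lam1 mulr_suml -big_split -subr_ge0 -sumrB /=.
    apply: le_trans slack _; rewrite le_eqVlt; apply/orP; left; apply/eqP.
    by apply: eq_bigr => w _; ring.
  have := cauchy_schwarz eta (F *m param U b).
  have := ler_wpM2l (norm2_ge0 eta) Exi; rewrite mulr1; lra.
have [|sigma Hsigma] := multipolar_slope (c := Lvec P u i 0) (g := g) hP hOmega.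
  move=> xi lam; have [U [b <-]] := param_surj xi.
  move=> Exi /(robust _ _ Exi); rewrite Lvec0_param V_sum; lra.
(* A pole is needed to bound [Lvec P u i sigma] on the ellipsoid. Without any, the weights of 0
   would sum to 0 instead of 1. *)
have [w0] : exists w : Omega, True.
  have [lam0 [_ _ lam0_sum]] : Defs.conv Omega 0.
    by apply: hOmega; exists 0; [exact: ellipsoid0|rewrite mulmx0].
  apply: contrapT => no_w; have /eqP := @oner_neq0 R; apply.
  by rewrite -lam0_sum big1 // => w _; case: no_w; exists w.
have [|eta Feta [xi Exi eta_norm]] :=
    @ellipsoid_support R _ _ F (Lvec P u i sigma)
      (((val w0)^T *m sigma) 0 0 - g w0).
  by move=> xi Exi; rewrite LvecE; exact: Hsigma.
exists eta, sigma; split; last by rewrite Feta subrr.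
(* The point [xi] where the form equals [norm2 eta] does not depend on the pole, so it serves for
   all of them. *)
move=> w; have := Hsigma xi w Exi.
by rewrite -LvecE -eta_norm /g; lra.
Qed.
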